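(* For any integer $K\ge2$, we have the following lower bounds. 1) If $\gamma\in(0,1)$: $$\inf_{Q,\hat F}\ \sup_{p\in\mathcal{P}_K}\mathbb{E}\left[(\hat F-F_\gamma)^2\right]\gtrsim_\gamma K^{2(1-\gamma)}\wedge\frac{K^{2-\gamma}}{\left(n(e^{2\alpha}-e^{-2\alpha})^2\right)^\gamma}.$$ 2) If $\gamma\in(1,2)$: $$\inf_{Q}\ \inf_{\hat F}\ \sup_{p\in\mathcal{P}_K}\mathbb{E}\left[(\hat F-F_\gamma)^2\right]\gtrsim_\gamma\frac{1}{\left[(e^{2\alpha}-e^{-2\alpha})^2n\right]^{2(\gamma-1)}}\wedge\frac{K^{2-\gamma}}{\left[(e^{2\alpha}-e^{-2\alpha})^2n\right]^\gamma}.$$ In both cases the infimum is taken over all estimators $\hat F$ and all $\alpha$-locally differentially private (LDP) sequentially interactive privacy mechanisms $Q$.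
   Context: $n$ is a positive integer, $[K]=\{1,\dots,K\}$, and the privacy level $\alpha\in(0,1)$ satisfies $\alpha^2n\ge1$. $\mathcal{P}_K=\{p\in[0,1]^K:\sum_{k=1}^Kp_k=1\}$, and $F_\gamma=F_\gamma(p)=\sum_{k=1}^Kp_k^\gamma$. The sensitive data $x_1,\dots,x_n$ are i.i.d. with $\mathbb{P}(x_i=k)=p_k$, $k\in[K]$. A sequentially interactive privacy mechanism $Q=(Q_1,\dots,Q_n)$ generates private samples $z_1,\dots,z_n$ successively, $z_i$ being drawn from a conditional distribution $Q_i(\cdot\mid x_i,z_1,\dots,z_{i-1})$ (for $i=1$ there is no conditioning on previous $z$'s). It is $\alpha$-LDP if for all $i=1,\dots,n$, $$\sup_{z_1,\dots,z_{i-1},x_i,x_i'}\frac{Q_i(\cdot\mid x_i,z_1,\dots,z_{i-1})}{Q_i(\cdot\mid x_i',z_1,\dots,z_{i-1})}\le e^\alpha,$$ i.e. $Q_i(A\mid x_i,z_1,\dots,z_{i-1})\le e^\alpha Q_i(A\mid x_i',z_1,\dots,z_{i-1})$ for every measurable set $A$ and all values of the arguments. An estimator $\hat F$ is a measurable function of the private samples $z_1,\dots,z_n$. $x\wedge y=\min\{x,y\}$. $x\gtrsim_\gamma y$ means $x\ge c_\gamma y$ for some constant $c_\gamma>0$ depending only on $\gamma$. *)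

(* Defs.v *)
From HB Require Import structures.
From mathcomp Require Import all_boot all_order all_algebra.
From mathcomp Require Import all_classical all_reals all_analysis.

Set Implicit Arguments.
Unset Strict Implicit.
Unset Printing Implicit Defensive.

Import Order.TTheory GRing.Theory Num.Theory.
Import numFieldNormedType.Exports.

Local Open Scope classical_set_scope.
Local Open Scope ring_scope.

(* Law of (Y, Z) when Y has law P and Z has conditional law k y given Y = y. *)
Section joint_law.
Local Open Scope ereal_scope.
Context (d d' : measure_display) (Y : measurableType d) (Z : measurableType d')
  (R : realType) (P : probability Y R) (k : R.-pker Y ~> Z).

Definition joint_law (A : set (Y * Z)) : \bar R :=
  \int[P]_y k y (xsection A y).

Let joint_law0 : joint_law set0 = 0.
Proof. by apply: integral0_eq => y _; rewrite xsection0 measure0. Qed.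

Let joint_law_ge0 A : 0 <= joint_law A.
Proof. exact: integral_ge0. Qed.

Let joint_law_sigma_additive : semi_sigma_additive joint_law.
Proof.
move=> A mA tA mUA.
rewrite [X in _ --> X](_ : _ =
    \int[P]_y (\sum_(n <oo) k y (xsection (A n) y))); last first.
  apply: eq_integral => y _; rewrite xsection_bigcup.
  apply/esym/cvg_lim => //; apply: measure_semi_sigma_additive.
  - by move=> n; exact: measurable_xsection.
  - exact: trivIset_xsection.
  - by apply: bigcup_measurable => n _; exact: measurable_xsection.
apply/cvg_closeP; split.
  by apply: is_cvg_nneseries => n _ _; exact: integral_ge0.
rewrite closeE// integral_nneseries// => n.
by apply: measurable_fun_xsection_finite_kernel; rewrite inE.
Qed.

HB.instance Definition _ := isMeasure.Build _ _ R joint_law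
  joint_law0 joint_law_ge0 joint_law_sigma_additive.

Let joint_law_setT : joint_law setT = 1.
Proof.
rewrite /joint_law (eq_integral (cst 1)) => [|y _].
  by rewrite integral_cst// mul1e; exact: probability_setT.
by rewrite xsectionE preimage_setT prob_kernel.
Qed.

HB.instance Definition _ :=
  Measure_isProbability.Build _ _ R joint_law joint_law_setT.

End joint_law.

(* The measurable space Z_0 * ... * Z_(i-1) of the first i private samples;
   each sample may live in its own measurable space. *)
Fixpoint samples_display (d : nat -> measure_display) (i : nat) :
    measure_display :=
  if i is j.+1 then measure_prod_display (samples_display d j, d j)
  else default_measure_display.

Fixpoint samples (d : nat -> measure_display)
    (Z : forall i, measurableType (d i)) (i : nat) :
    measurableType (samples_display d i) :=
  match i with
  | 0 => unit
  | j.+1 => (samples Z j * Z j)%type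
  end.

(* Indices are shifted: channel i k is the law of z_(i+1) given
   z_1, ..., z_i and x_(i+1) = k. With n observations, only the channels of
   index i < n are used. The data alphabet [K] is 'I_K. *)
Record mechanism (R : realType) (K : nat) := Mechanism {
  sample_display : nat -> measure_display ;
  sample_space : forall i, measurableType (sample_display i) ;
  channel : forall i, 'I_K -> R.-pker (samples sample_space i) ~> sample_space i
}.

Arguments channel {R K} m i k.

Definition LDP (R : realType) (K n : nat) (alpha : R)
    (Q : mechanism R K) : Prop :=
  forall (i : nat) (h : samples (sample_space Q) i) (k k' : 'I_K)
         (A : set (sample_space Q i)),
    (i < n)%N -> measurable A ->
    (channel Q i k h A <= (expR alpha)%:E * channel Q i k' h A)%E.

(* Law of (z_1, ..., z_n) given the data (x_1, ..., x_n) = x. *)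
Fixpoint samples_law (R : realType) (K : nat) (Q : mechanism R K) (n : nat) :
    ('I_n -> 'I_K) -> probability (samples (sample_space Q) n) R :=
  match n with
  | 0 => fun=> \d_tt
  | m.+1 => fun x =>
      joint_law (samples_law Q (fun i : 'I_m => x (widen_ord (leqnSn m) i)))
                (channel Q m (x ord_max))
  end.

Definition simplex (R : realType) (K : nat) : set ('I_K -> R) :=
  [set p | (forall k, 0 <= p k <= 1) /\ \sum_(k < K) p k = 1].

Definition power_sum (R : realType) (K : nat) (gamma : R) (p : 'I_K -> R) : R :=
  \sum_(k < K) p k `^ gamma.

(* Expectation over x_1, ..., x_n i.i.d. with law p of the conditional
   expectation given the data. *)
Definition risk (R : realType) (K n : nat) (gamma : R) (Q : mechanism R K)
    (F : samples (sample_space Q) n -> R) (p : 'I_K -> R) : \bar R :=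
  (\sum_(x : {ffun 'I_n -> 'I_K}) (\prod_(i < n) p (x i))%:E *
     'E_(samples_law Q x) [fun z => (F z - power_sum gamma p) ^+ 2]%R)%E.

Definition max_risk (R : realType) (K n : nat) (gamma : R) (Q : mechanism R K)
    (F : samples (sample_space Q) n -> R) : \bar R :=
  ereal_sup [set risk gamma F p | p in @simplex R K].

Definition estimator (R : realType) (K n : nat) (Q : mechanism R K) :
    set (samples (sample_space Q) n -> R) :=
  [set F | measurable_fun [set: samples (sample_space Q) n] F].

(* Main.v *)
(* Le Cam's method with a mixture.  Perturb a distribution p0 by
   p_e = p0 + delta * sum_j s_j(e) (1_{u_j} - 1_{v_j}), with s_j Rademacher signs;
   doubling one entry of each pair {u_j, v_j} and cancelling the other changes
   F_gamma by an amount that does not depend on e.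

   With phi(x) = 2 x - x^2, the quantity
   sum_e (E_{p0} phi(g_e) - phi(E_{p_e} g_e)) is a divergence between p0 and the
   family (p_e) which needs no densities.  It is subadditive along the
   successive channels, because conditioning on the past under p0 does not
   involve e.  Within one step, with u_e = g_e - E_{p_e} g_e, its e-th term
   equals phi'(E_{p_e} g_e) E_{p0} u_e - E_{p0} u_e^2; local privacy bounds the
   linear part by (e^alpha - e^-alpha) delta sum_j |W_j|, where
   W_j = sum_e s_j(e) phi'(E_{p_e} g_e) u_e, and Bessel's inequality together
   with AM-GM absorbs it into the quadratic part at the price of
   J delta^2 (e^alpha - e^-alpha)^2, where J is the number of pairs.  Hence no
   test distinguishes p0 from the mixture as long as
   n J delta^2 (e^alpha - e^-alpha)^2 is small.  The rates follow by choosing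
   delta = (J N)^(-1/2), or delta = 1/(2 J) when N < 4 J and gamma < 1; for
   gamma > 1, J is reduced to at most N / 4.  For K = 2 there is no room for a
   pair besides the entry carrying the remaining mass, and (delta, 1 - delta)
   is compared with (0, 1). *)
From HB Require Import structures.
Require Import Defs.
From mathcomp Require Import all_boot all_order all_algebra.
From mathcomp Require Import all_classical all_reals all_analysis.
From mathcomp Require Import measurable_realfun giry.
From mathcomp Require Import ring lra zify.

Set Implicit Arguments.
Unset Strict Implicit.
Unset Printing Implicit Defensive.

Import Order.TTheory GRing.Theory Num.Theory.
Import numFieldNormedType.Exports.

Local Open Scope classical_set_scope.
Local Open Scope ring_scope.

(** * Integration against the joint law of a kernel *)

Section kernel_probability.
Context (d d' : measure_display) (Y : measurableType d) (Z : measurableType d')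
  (R : realType) (k : R.-pker Y ~> Z) (y : Y).

(* The library registers k y only as a measure. *)
Definition kernel_at : set Z -> \bar R := k y.

HB.instance Definition _ := Measure.on kernel_at.

Let kernel_at_setT : kernel_at [set: Z] = 1%E.
Proof. exact: prob_kernel. Qed.

HB.instance Definition _ :=
  Measure_isProbability.Build _ _ R kernel_at kernel_at_setT.

End kernel_probability.

(** Tonelli's formula for a kernel: the joint law is the Giry bind of [P] along [fiber], where
    [fiber y] is the image of [k y] under pairing with [y]. *)
Lemma integral_joint_law (d d' : measure_display) (Y : measurableType d)
    (Z : measurableType d') (R : realType) (P : probability Y R)
    (k : R.-pker Y ~> Z) (f : Y * Z -> \bar R) :
  measurable_fun [set: Y * Z] f -> (forall z, 0 <= f z)%E ->
  (\int[joint_law P k]_z f z = \int[P]_y \int[k y]_z f (y, z))%E.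
Proof.
move=> mf f0.
pose fiber y : giry (Y * Z)%type R := giry_map (measurable_pair1 y) (kernel_at k y).
have mfiber : measurable_fun [set: Y] fiber.
  apply: measurable_giry_codensity => // B mB.
  rewrite (_ : fiber ^~ B = fun y => k y (xsection B y)).
    by apply: measurable_fun_xsection_finite_kernel; rewrite inE.
  by apply/funext => y; rewrite xsectionE.
have := giry_int_bind (P : giry Y R) mfiber mf f0.
rewrite [giry_int _ _ in X in X -> _](_ : _ = (\int[joint_law P k]_z f z)%E).
  move=> ->; apply: eq_integral => y _.
  by rewrite giry_int_map.
apply: eq_measure_integral => A mA _.
apply: etrans (giry_int_map mfiber _ (measurable_giry_ev mA) _) _ => //.
by apply: eq_integral => y _; rewrite /= /giry_ev xsectionE.
Qed.

(** * Bounded measurable functions *)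

Section bounded_measurable.
Context (d : measure_display) (T : measurableType d) (R : realType).
Implicit Types (P : probability T R) (f g : T -> R).

(** Such functions are integrable for all probability measures at once, so one membership proof
    serves every channel and every data vector. *)
Definition bounded_measurable f :=
  measurable_fun [set: T] f /\ exists M, forall x, `|f x| <= M.

Lemma bounded_measurable_integrable P f :
  bounded_measurable f -> P.-integrable [set: T] (EFin \o f).
Proof.
move=> [mf [M fM]]; apply: measurable_bounded_integrable => //.
  by rewrite ltey_eq fin_num_measure.
by exists M; split; [exact: num_real|move=> x Mx y _; exact: le_trans (ltW Mx)].
Qed.

Lemma bounded_measurable01 f : measurable_fun [set: T] f ->
  (forall x, 0 <= f x <= 1) -> bounded_measurable f.
Proof.
by move=> mf f01; split=> //; exists 1 => x; have /andP[] := f01 x; move=> /ger0_norm ->.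
Qed.

Lemma bounded_measurable_cst r : bounded_measurable (fun=> r).
Proof. by split; [exact: measurable_cst|exists `|r|]. Qed.

Lemma bounded_measurableD f g : bounded_measurable f -> bounded_measurable g ->
  bounded_measurable (fun x => f x + g x).
Proof.
move=> [mf [M fM]] [mg [N gN]]; split; first exact: measurable_funD.
by exists (M + N) => x; rewrite (le_trans (ler_normD _ _))// lerD.
Qed.

Lemma bounded_measurableM f g : bounded_measurable f -> bounded_measurable g ->
  bounded_measurable (fun x => f x * g x).
Proof.
move=> [mf [M fM]] [mg [N gN]]; split; first exact: measurable_funM.
by exists (M * N) => x; rewrite normrM ler_pM.
Qed.

Lemma bounded_measurableZ r f : bounded_measurable f ->
  bounded_measurable (fun x => r * f x).
Proof. exact/bounded_measurableM/bounded_measurable_cst. Qed.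

Lemma bounded_measurableB f g : bounded_measurable f -> bounded_measurable g ->
  bounded_measurable (fun x => f x - g x).
Proof.
move=> bf bg; under eq_fun do rewrite -mulN1r.
exact/bounded_measurableD/bounded_measurableZ.
Qed.

Lemma bounded_measurableX f n : bounded_measurable f ->
  bounded_measurable (fun x => f x ^+ n).
Proof.
move=> [mf [M fM]]; split; first exact: measurable_funX.
by exists (M ^+ n) => x; rewrite normrX lerXn2r// nnegrE// (le_trans _ (fM x)).
Qed.

Lemma bounded_measurable_norm f : bounded_measurable f ->
  bounded_measurable (fun x => `|f x|).
Proof.
move=> [mf [M fM]]; split; first exact: measurableT_comp.
by exists M => x; rewrite normr_id.
Qed.

Lemma bounded_measurable_sum (I : Type) (s : seq I) (h : I -> T -> R) :
  (forall i, bounded_measurable (h i)) ->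
  bounded_measurable (fun x => \sum_(i <- s) h i x).
Proof.
move=> bh; elim: s => [|i s ih].
  by under eq_fun do rewrite big_nil; exact: bounded_measurable_cst.
by under eq_fun do rewrite big_cons; exact: bounded_measurableD.
Qed.

Lemma Rintegral_sum_bounded P (I : Type) (s : seq I) (h : I -> T -> R) :
  (forall i, bounded_measurable (h i)) ->
  \int[P]_x (\sum_(i <- s) h i x) = \sum_(i <- s) \int[P]_x h i x.
Proof.
move=> bh; elim: s => [|i s ih].
  by under eq_Rintegral do rewrite big_nil; rewrite Rintegral_cst// big_nil mul0r.
under eq_Rintegral do rewrite big_cons.
rewrite RintegralD ?ih ?big_cons//.
  exact: bounded_measurable_integrable.
by apply: bounded_measurable_integrable; exact: bounded_measurable_sum.
Qed.

Lemma Rintegral_probability_cst P r : \int[P]_x r = r.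
Proof.
by rewrite Rintegral_cst//= probability_setT mulr1.
Qed.

End bounded_measurable.

(** * Means under finite mixtures *)

Section mixture_mean.
Context (d : measure_display) (Z : measurableType d) (R : realType).
Context (I : finType) (q : I -> probability Z R) (p : I -> R).
Implicit Types f g : Z -> R.

(** The index type is arbitrary: it is the alphabet when one channel is averaged, and the set of
    data vectors when the whole private sample is. *)
Definition mixture_mean f : R := \sum_i p i * \int[q i]_z f z.

Lemma mixture_meanB f g : bounded_measurable f -> bounded_measurable g ->
  mixture_mean (fun z => f z - g z) = mixture_mean f - mixture_mean g.
Proof.
move=> bf bg; rewrite -sumrB; apply: eq_bigr => i _ /=.
by rewrite RintegralB ?mulrBr//; exact: bounded_measurable_integrable.
Qed.

Lemma mixture_meanZ r f : bounded_measurable f ->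
  mixture_mean (fun z => r * f z) = r * mixture_mean f.
Proof.
move=> bf; rewrite mulr_sumr; apply: eq_bigr => i _ /=.
by rewrite (RintegralZl r measurableT (bounded_measurable_integrable _ bf)) mulrCA.
Qed.

Lemma mixture_mean_sum (J : Type) (r : seq J) (h : J -> Z -> R) :
  (forall j, bounded_measurable (h j)) ->
  mixture_mean (fun z => \sum_(j <- r) h j z) = \sum_(j <- r) mixture_mean (h j).
Proof.
move=> bh; rewrite exchange_big; apply: eq_bigr => i _ /=.
by rewrite Rintegral_sum_bounded// mulr_sumr.
Qed.

Hypothesis p_ge0 : forall i, 0 <= p i.

Lemma mixture_mean_le f g : bounded_measurable f -> bounded_measurable g ->
  (forall z, f z <= g z) -> mixture_mean f <= mixture_mean g.
Proof.
move=> bf bg fg; apply: ler_sum => i _; apply: ler_wpM2l => //.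
by apply: le_Rintegral => //; exact: bounded_measurable_integrable.
Qed.

Hypothesis p_sum : \sum_i p i = 1.

Lemma mixture_mean_cst r : mixture_mean (fun=> r) = r.
Proof.
rewrite /mixture_mean; under eq_bigr do rewrite Rintegral_probability_cst.
by rewrite -mulr_suml p_sum mul1r.
Qed.

Lemma mixture_mean01 f : measurable_fun [set: Z] f ->
  (forall z, 0 <= f z <= 1) -> 0 <= mixture_mean f <= 1.
Proof.
move=> mf f01; have bf := bounded_measurable01 mf f01.
have bc r := @bounded_measurable_cst _ Z R r.
apply/andP; split.
  by rewrite -(mixture_mean_cst 0); apply: mixture_mean_le => // z;
    have /andP[] := f01 z.
by rewrite -[leRHS](mixture_mean_cst 1); apply: mixture_mean_le => // z;
  have /andP[] := f01 z.
Qed.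

End mixture_mean.

(** * Divergence created by one private channel *)

Section one_step.
Context (d : measure_display) (Z : measurableType d) (R : realType).
Context (K : nat) (q : 'I_K -> probability Z R) (alpha : R).
Hypothesis q_LDP : forall (k l : 'I_K) (A : set Z), measurable A ->
  (q k A <= (expR alpha)%:E * q l A)%E.

(** Privacy says that [q k] is dominated, as a measure, by [q l] scaled by [expR alpha]. *)
Lemma LDP_integral (k l : 'I_K) (f : Z -> R) :
  bounded_measurable f -> (forall z, 0 <= f z) ->
  \int[q k]_z f z <= expR alpha * \int[q l]_z f z.
Proof.
move=> bf f0; have i (P : probability Z R) := bounded_measurable_integrable P bf.
have c0 : 0 <= expR alpha by exact: expR_ge0.
rewrite -lee_fin EFinM /Rintegral !fineK; last 2 first.
  exact: integrable_fin_num (i _).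
  exact: integrable_fin_num (i _).
have f0' z : [set: Z] z -> (0 <= (f z)%:E)%E by rewrite lee_fin.
have mf : measurable_fun [set: Z] (EFin \o f) by exact/measurable_EFinP/bf.1.
rewrite -(ge0_integral_mscale _ measurableT (NngNum c0) mf f0').
by apply: ge0_le_measure_integral => // A mA; exact: q_LDP.
Qed.

(** Passing through the reference letter [m], the bounds [x <= a * w] and [w <= a * y] give
    [x - y <= (a - b) * w] with [b] the inverse of [a]. This is applied to the nonnegative functions
    [|f| + f] and, with [k] and [l] exchanged, [|f| - f]; half the sum is the claim. *)
Lemma LDP_integral_diff (k l m : 'I_K) (f : Z -> R) : bounded_measurable f ->
  \int[q k]_z f z - \int[q l]_z f z <=
  (expR alpha - expR (- alpha)) * \int[q m]_z `|f z|.
Proof.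
move=> bf; have bn := bounded_measurable_norm bf.
have i (P : probability Z R) := bounded_measurable_integrable P bf.
have ni (P : probability Z R) := bounded_measurable_integrable P bn.
pose a := expR alpha; pose b := expR (- alpha).
have ab : b * a = 1 by rewrite -expRD addNr expR0.
have b0 : 0 < b by exact: expR_gt0.
have fp z : 0 <= `|f z| + f z by rewrite -lerBlDr sub0r ler_normr lexx orbT.
have fm z : 0 <= `|f z| - f z by rewrite subr_ge0 ler_norm.
have D1 (x y w : R) : x <= a * w -> w <= a * y -> x - y <= (a - b) * w.
  move=> xw /(ler_wpM2l (ltW b0)); rewrite mulrA ab mul1r => wy.
  by rewrite mulrBl lerB.
have bp := bounded_measurableD bn bf; have bm := bounded_measurableB bn bf.
have := D1 _ _ _ (LDP_integral k m bp fp) (LDP_integral m l bp fp).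
have := D1 _ _ _ (LDP_integral l m bm fm) (LDP_integral m k bm fm).
have eD P := RintegralD measurableT (ni P) (i P).
have eB P := RintegralB measurableT (ni P) (i P).
rewrite !eD !eB -/a -/b; lra.
Qed.

Variables (E : finType) (J : nat) (p0 : 'I_K -> R) (p : E -> 'I_K -> R) (tau : R).
Variables (s : 'I_J -> E -> R) (u v : 'I_J -> 'I_K).
Hypothesis p0_ge0 : forall k, 0 <= p0 k.
Hypothesis p0_sum : \sum_(k < K) p0 k = 1.
Hypothesis p_ge0 : forall e k, 0 <= p e k.
Hypothesis p_sum : forall e, \sum_(k < K) p e k = 1.
Hypothesis E_gt0 : (0 < #|E|)%N.
Hypothesis tau_ge0 : 0 <= tau.
Hypothesis bessel : forall w : E -> R,
  \sum_(j < J) (\sum_e s j e * w e) ^+ 2 <= #|E|%:R * \sum_e w e ^+ 2.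
Hypothesis perturbation : forall e (x : 'I_K -> R),
  \sum_(k < K) p e k * x k =
  \sum_(k < K) p0 k * x k + tau * \sum_(j < J) s j e * (x (u j) - x (v j)).

Local Notation a := (expR alpha - expR (- alpha)).
Local Notation phi := (fun x : R => 2 * x - x ^+ 2).

Lemma mixture_mean_perturbation (e : E) (f : Z -> R) :
  mixture_mean q (p e) f = mixture_mean q p0 f +
  tau * \sum_(j < J) s j e * (\int[q (u j)]_z f z - \int[q (v j)]_z f z).
Proof. exact: perturbation. Qed.

(** The signs enter only through [bessel], and [perturbation] is tested against arbitrary vectors;
    hence one statement serves both the Rademacher family and the single alternative used for two
    letters. *)
Lemma one_step_divergence (g : E -> Z -> R) :
  (forall e, measurable_fun [set: Z] (g e)) ->
  (forall e z, 0 <= g e z <= 1) ->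
  \sum_e (mixture_mean q p0 (fun z => phi (g e z)) -
           phi (mixture_mean q (p e) (g e))) <=
  #|E|%:R * (J%:R * (tau * a) ^+ 2).
Proof.
move=> mg g01; pose c e := mixture_mean q (p e) (g e).
have c01 e : 0 <= c e <= 1 by exact: mixture_mean01.
have bg e : bounded_measurable (g e) by exact: bounded_measurable01.
pose dev e z := g e z - c e.
have bdev e : bounded_measurable (dev e).
  by apply: bounded_measurableB => //; exact: bounded_measurable_cst.
pose w e z := (2 - 2 * c e) * dev e z.
have bw e : bounded_measurable (w e) by exact: bounded_measurableZ.
pose W j z := \sum_e s j e * w e z.
have bW j : bounded_measurable (W j).
  by apply: bounded_measurable_sum => e; exact: bounded_measurableZ.
have bdev2 e : bounded_measurable (fun z => dev e z ^+ 2).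
  exact: bounded_measurableX.
(* Exact expansion of phi around c e; the constants cancel in the linear part. *)
have E1 e : mixture_mean q p0 (fun z => phi (g e z)) - phi (c e) =
    - (tau * \sum_(j < J) s j e * (\int[q (u j)]_z w e z - \int[q (v j)]_z w e z))
    - mixture_mean q p0 (fun z => dev e z ^+ 2).
  have w_mean (P : probability Z R) :
      \int[P]_z w e z = (2 - 2 * c e) * (\int[P]_z g e z - c e).
    rewrite (RintegralZl _ measurableT (bounded_measurable_integrable _ (bdev e))).
    rewrite RintegralB//; last 2 first.
      exact: bounded_measurable_integrable.
      by apply: bounded_measurable_integrable; exact: bounded_measurable_cst.
    by rewrite Rintegral_probability_cst.
  under eq_bigr do rewrite !w_mean -mulrBr opprB addrA subrK mulrCA.
  rewrite -mulr_sumr mulrCA.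
  have := mixture_mean_perturbation e (g e); rewrite -/(c e) => ce.
  have -> : tau * \sum_(j < J) s j e * (\int[q (u j)]_z g e z - \int[q (v j)]_z g e z) =
    c e - mixture_mean q p0 (g e) by rewrite [X in X - _]ce addrC addKr.
  rewrite mixture_meanB; [|exact: bounded_measurableZ|exact: bounded_measurableX].
  rewrite mixture_meanZ//.
  have -> : (fun z => dev e z ^+ 2) =
      (fun z => g e z ^+ 2 - (2 * c e * g e z - c e ^+ 2)).
    by apply/funext => z; rewrite /dev; ring.
  have bcg : bounded_measurable (fun z => 2 * c e * g e z) by exact: bounded_measurableZ.
  have bcc := bounded_measurable_cst Z (c e ^+ 2).
  rewrite mixture_meanB; [|exact: bounded_measurableX|exact: bounded_measurableB].
  rewrite mixture_meanB// mixture_meanZ// mixture_mean_cst//; ring.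
rewrite (eq_bigr _ (fun e _ => E1 e)) sumrB sumrN -mulr_sumr exchange_big/=.
have E2 j : \sum_e s j e * (\int[q (u j)]_z w e z - \int[q (v j)]_z w e z) =
    \int[q (u j)]_z W j z - \int[q (v j)]_z W j z.
  rewrite !Rintegral_sum_bounded; do ?[by move=> e; exact: bounded_measurableZ].
  rewrite -sumrB; apply: eq_bigr => e _.
  by rewrite !(RintegralZl _ measurableT (bounded_measurable_integrable _ (bw e))) mulrBr.
rewrite (eq_bigr _ (fun j _ => E2 j)) -mixture_mean_sum//.
have bnW j : bounded_measurable (fun z => `|W j z|) by exact: bounded_measurable_norm.
have bsnW : bounded_measurable (fun z => tau * a * \sum_(j < J) `|W j z|).
  by apply/bounded_measurableZ/bounded_measurable_sum.
have bsdev : bounded_measurable (fun z => \sum_e dev e z ^+ 2).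
  exact: bounded_measurable_sum.
have E3 : - (tau * \sum_(j < J) (\int[q (u j)]_z W j z - \int[q (v j)]_z W j z)) <=
    mixture_mean q p0 (fun z => tau * a * \sum_(j < J) `|W j z|).
  rewrite -[leLHS]mul1r -p0_sum mulr_suml; apply: ler_sum => m _.
  apply: ler_wpM2l => //; rewrite RintegralZl; last 2 first.
    exact: measurableT.
    by apply: bounded_measurable_integrable; exact: bounded_measurable_sum.
  rewrite Rintegral_sum_bounded// -mulrN -mulrA; apply: ler_wpM2l => //.
  rewrite -sumrN mulr_sumr; apply: ler_sum => j _; rewrite opprB.
  exact: LDP_integral_diff.
apply: le_trans (lerB E3 (lexx _)) _; rewrite -mixture_meanB//.
(* All terms are now means under [p0], so it is enough to compare the integrands at each [z]. *)
rewrite -[leRHS](mixture_mean_cst q p0_sum).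
apply: mixture_mean_le => //; [exact: bounded_measurableB|exact: bounded_measurable_cst|].
move=> z /=; set t := tau * a.
have N0 : (0 : R) < #|E|%:R by rewrite ltr0n.
rewrite -(ler_pM2l N0) mulrBr lerBlDr.
(* Bessel's inequality at fixed [z]; the factor 4 bounds the square of [2 - 2 * c e], as [c e] lies
   in [0, 1]. *)
have W2 : \sum_(j < J) `|W j z| ^+ 2 <= 4 * (#|E|%:R * \sum_e dev e z ^+ 2).
  under eq_bigr do rewrite real_normK ?num_real//.
  rewrite mulrCA; apply: le_trans (bessel (fun e => w e z)) _.
  rewrite ler_pM2l// mulr_sumr; apply: ler_sum => e _.
  rewrite exprMn ler_wpM2r ?sqr_ge0//.
  have /andP[c0 c1] := c01 e; nra.
(* The weight 1/4 cancels the factor 4 of [W2], so the quadratic part absorbs the first term on the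
   right. *)
suff AMGM : #|E|%:R * (t * \sum_(j < J) `|W j z|) <=
    4^-1 * (\sum_(j < J) `|W j z| ^+ 2) + #|E|%:R * (#|E|%:R * (J%:R * t ^+ 2)).
  lra.
have -> : J%:R * t ^+ 2 = \sum_(j < J) t ^+ 2.
  by rewrite sumr_const card_ord mulr_natl.
rewrite !mulr_sumr -big_split; apply: ler_sum => j _ /=.
have := sqr_ge0 (`|W j z| / 2 - #|E|%:R * t); nra.
Qed.

End one_step.

(** * Private samples generated by successive channels *)

Section sequential.
Context (R : realType) (K : nat) (Q : mechanism R K).

Definition data_weight (p : 'I_K -> R) (m : nat) (x : {ffun 'I_m -> 'I_K}) : R :=
  \prod_(i < m) p (x i).

Lemma data_weight_ge0 (p : 'I_K -> R) m (x : {ffun 'I_m -> 'I_K}) :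
  (forall k, 0 <= p k) -> 0 <= data_weight p x.
Proof. by move=> p0; apply: prodr_ge0. Qed.

Lemma sum_data_weight (p : 'I_K -> R) m : \sum_k p k = 1 ->
  \sum_(x : {ffun 'I_m -> 'I_K}) data_weight p x = 1.
Proof.
move=> p1; rewrite -(bigA_distr_bigA (fun=> p)).
by rewrite big1.
Qed.

Definition samples_mean (p : 'I_K -> R) (m : nat)
    (f : samples (sample_space Q) m -> R) : R :=
  mixture_mean (fun x : {ffun 'I_m -> 'I_K} => samples_law Q x) (@data_weight p m) f.

Definition channel_at i (h : samples (sample_space Q) i) (k : 'I_K) :
  probability (sample_space Q i) R := kernel_at (channel Q i k) h.

Definition channel_mean (p : 'I_K -> R) i (f : samples (sample_space Q) i.+1 -> R)
    (h : samples (sample_space Q) i) : R :=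
  mixture_mean (channel_at h) p (fun z => f (h, z)).

Lemma measurable_channel_integral m k (f : samples (sample_space Q) m.+1 -> R) :
  measurable_fun [set: samples (sample_space Q) m.+1] f ->
  (forall z, 0 <= f z <= 1) ->
  measurable_fun [set: samples (sample_space Q) m]
    (fun h => \int[channel_at h k]_z f (h, z)).
Proof.
move=> mf f01; apply: measurableT_comp => //.
apply: (@measurable_fun_integral_finite_kernel _ _ _ _ _ (EFin \o f)).
  by move=> z; rewrite lee_fin; have /andP[] := f01 z.
exact/measurable_EFinP.
Qed.

Lemma measurable_section m (f : samples (sample_space Q) m.+1 -> R) h :
  measurable_fun [set: samples (sample_space Q) m.+1] f ->
  measurable_fun [set: sample_space Q m] (fun z => f (h, z)).
Proof. by move=> mf; exact: measurableT_comp. Qed.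

Lemma channel_integral01 m k (f : samples (sample_space Q) m.+1 -> R) :
  measurable_fun [set: samples (sample_space Q) m.+1] f ->
  (forall z, 0 <= f z <= 1) ->
  forall h, 0 <= \int[channel_at h k]_z f (h, z) <= 1.
Proof.
move=> mf f01 h; rewrite Rintegral_ge0; last first.
  by move=> z _; have /andP[] := f01 (h, z).
rewrite -[leRHS](Rintegral_probability_cst (channel_at h k)).
apply: le_Rintegral => //.
- apply: bounded_measurable_integrable; apply: bounded_measurable01 => //.
  exact: measurable_section.
- by apply: bounded_measurable_integrable; exact: bounded_measurable_cst.
- by move=> z _; have /andP[] := f01 (h, z).
Qed.

Lemma measurable_channel_mean (p : 'I_K -> R) m (f : samples (sample_space Q) m.+1 -> R) :
  measurable_fun [set: samples (sample_space Q) m.+1] f ->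
  (forall z, 0 <= f z <= 1) ->
  measurable_fun [set: samples (sample_space Q) m] (channel_mean p f).
Proof.
move=> mf f01; apply: measurable_sum => k; apply: measurable_funM => //.
exact: measurable_channel_integral.
Qed.

(** The new letter sits at [ord_max], in accordance with the recursion of [samples_law]. *)
Definition ffun_rcons m (x : {ffun 'I_m -> 'I_K}) (k : 'I_K) :
    {ffun 'I_m.+1 -> 'I_K} :=
  [ffun i => oapp x k (unlift ord_max i)].

Lemma ffun_rcons_max m (x : {ffun 'I_m -> 'I_K}) k :
  ffun_rcons x k ord_max = k.
Proof. by rewrite ffunE unlift_none. Qed.

Lemma ffun_rcons_widen m (x : {ffun 'I_m -> 'I_K}) k i :
  ffun_rcons x k (widen_ord (leqnSn m) i) = x i.
Proof.
rewrite ffunE (_ : widen_ord _ _ = lift ord_max i) ?liftK//.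
by apply/val_inj; rewrite /= /bump leqNgt ltn_ord.
Qed.

Lemma sum_ffun_rcons m (G : {ffun 'I_m.+1 -> 'I_K} -> R) :
  \sum_x G x = \sum_(x : {ffun 'I_m -> 'I_K}) \sum_k G (ffun_rcons x k).
Proof.
rewrite pair_bigA /= (reindex (fun xk => ffun_rcons xk.1 xk.2))//=.
exists (fun x => ([ffun i => x (widen_ord (leqnSn m) i)], x ord_max)).
  move=> [x k] _ /=; rewrite ffun_rcons_max; congr pair.
  by apply/ffunP => i; rewrite ffunE ffun_rcons_widen.
move=> x _ /=; apply/ffunP => i; rewrite ffunE.
case: unliftP => [j ->|->//] /=; rewrite ffunE; congr (x _).
by apply/val_inj; rewrite /= /bump leqNgt ltn_ord.
Qed.

(** Tower property: the last letter is independent of the earlier ones, hence of the past private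
    samples, so given the past the last sample follows the [p]-mixture of the channels. *)
Lemma samples_meanS (p : 'I_K -> R) m (f : samples (sample_space Q) m.+1 -> R) :
  measurable_fun [set: samples (sample_space Q) m.+1] f ->
  (forall z, 0 <= f z <= 1) ->
  samples_mean p f = samples_mean p (channel_mean p f).
Proof.
move=> mf f01; rewrite /samples_mean /mixture_mean sum_ffun_rcons.
apply: eq_bigr => x _; rewrite /channel_mean /mixture_mean.
rewrite Rintegral_sum_bounded.
  rewrite mulr_sumr; apply: eq_bigr => k _.
  rewrite /data_weight big_ord_recr /= ffun_rcons_max.
  rewrite -mulrA; congr (_ * _).
    by apply: eq_bigr => i _; rewrite ffun_rcons_widen.
  pose g h := \int[channel_at h k]_z f (h, z).
  have bg : bounded_measurable g.
    apply: bounded_measurable01; first exact: measurable_channel_integral.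
    exact: channel_integral01.
  rewrite (RintegralZl _ measurableT (bounded_measurable_integrable _ bg)).
  congr (_ * _); rewrite /Rintegral integral_joint_law; last 2 first.
    exact/measurable_EFinP.
    by move=> z; rewrite lee_fin; have /andP[] := f01 z.
  rewrite (_ : (fun i => ffun_rcons x k (widen_ord _ i)) = x); last first.
    by apply/funext => i; rewrite ffun_rcons_widen.
  congr fine; apply: eq_integral => h _; rewrite /g /Rintegral fineK//.
  apply: (integrable_fin_num measurableT).
  apply: (bounded_measurable_integrable (channel_at h k)).
  apply: bounded_measurable01 => //; exact: measurable_section.
move=> k; apply: bounded_measurableZ; apply: bounded_measurable01.
  exact: measurable_channel_integral.
exact: channel_integral01.
Qed.

End sequential.

(** * Divergence of the whole sample and the testing bound *)

Section divergence.
Context (R : realType) (K : nat) (Q : mechanism R K) (n : nat) (alpha : R).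
Hypothesis Q_LDP : LDP n alpha Q.
Variables (E : finType) (J : nat) (p0 : 'I_K -> R) (p : E -> 'I_K -> R) (tau : R).
Variables (s : 'I_J -> E -> R) (u v : 'I_J -> 'I_K).
Hypothesis p0_simplex : simplex p0.
Hypothesis p_simplex : forall e, simplex (p e).
Hypothesis E_gt0 : (0 < #|E|)%N.
Hypothesis tau_ge0 : 0 <= tau.
Hypothesis bessel : forall w : E -> R,
  \sum_(j < J) (\sum_e s j e * w e) ^+ 2 <= #|E|%:R * \sum_e w e ^+ 2.
Hypothesis perturbation : forall e (x : 'I_K -> R),
  \sum_(k < K) p e k * x k =
  \sum_(k < K) p0 k * x k + tau * \sum_(j < J) s j e * (x (u j) - x (v j)).

Local Notation a := (expR alpha - expR (- alpha)).
Local Notation phi := (fun x : R => 2 * x - x ^+ 2).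

Let p0_ge0 k : 0 <= p0 k. Proof. by have [/(_ k)/andP[]] := p0_simplex. Qed.
Let p_ge0 e k : 0 <= p e k. Proof. by have [/(_ k)/andP[]] := p_simplex e. Qed.

(** Induction on the sample size. Conditioning on the past turns [g] into [G] under the
    alternatives, and [phi] of [g] into [H] under [p0]; the term of [e] splits into a one-step
    divergence averaged over the past and the divergence of [G] on [m] samples. *)
Lemma samples_divergence m (g : E -> samples (sample_space Q) m -> R) :
  (m <= n)%N ->
  (forall e, measurable_fun [set: samples (sample_space Q) m] (g e)) ->
  (forall e z, 0 <= g e z <= 1) ->
  \sum_e (samples_mean p0 (fun z => phi (g e z)) - phi (samples_mean (p e) (g e))) <=
  m%:R * (#|E|%:R * (J%:R * (tau * a) ^+ 2)).
Proof.
elim: m g => [|m IH] g mn mg g01.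
  (* Without samples the space is a single point and both terms of the difference coincide. *)
  rewrite mul0r (eq_bigr (fun=> 0)) ?big1// => e _.
  have cst p' (f : samples (sample_space Q) 0 -> R) :
      simplex p' -> samples_mean p' f = f tt.
    move=> [_ p'1]; rewrite (_ : f = fun=> f tt); last by apply/funext => -[].
    by rewrite [LHS]mixture_mean_cst// sum_data_weight.
  by rewrite !cst// subrr.
have phi01 (x : R) : 0 <= x <= 1 -> 0 <= phi x <= 1.
  by move=> /andP[x0 x1]; apply/andP; split; nra.
have mphi (d : measure_display) (T : measurableType d) (f : T -> R) :
    measurable_fun [set: T] f -> measurable_fun [set: T] (fun x => phi (f x)).
  move=> mf; apply: measurable_funB; last exact: measurable_funX.
  by apply: measurable_funM => //; exact: measurable_cst.
pose G e := channel_mean (p e) (g e).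
have mG e : measurable_fun [set: samples (sample_space Q) m] (G e).
  exact: measurable_channel_mean.
have G01 e z : 0 <= G e z <= 1.
  apply: mixture_mean01 => //; first by have [] := p_simplex e.
  exact: measurable_section.
pose H e := channel_mean p0 (fun z => phi (g e z)).
have mH e : measurable_fun [set: samples (sample_space Q) m] (H e).
  by apply: measurable_channel_mean => [|z]; [exact: mphi|exact: phi01].
have H01 e z : 0 <= H e z <= 1.
  apply: mixture_mean01 => //; first by have [] := p0_simplex.
    by apply: mphi; exact: measurable_section.
  by move=> ?; exact: phi01.
have bH e : bounded_measurable (H e) by exact: bounded_measurable01.
have bphiG e : bounded_measurable (fun z => phi (G e z)).
  by apply: bounded_measurable01 => [|z]; [exact: mphi|exact: phi01].
have split_e e : samples_mean p0 (fun z => phi (g e z)) - phi (samples_mean (p e) (g e)) =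
    samples_mean p0 (fun z => H e z - phi (G e z)) +
    (samples_mean p0 (fun z => phi (G e z)) - phi (samples_mean (p e) (G e))).
  rewrite samples_meanS//; [|exact: mphi|by move=> ?; exact: phi01].
  rewrite [samples_mean (p e) (g e)]samples_meanS//.
  by rewrite [samples_mean p0 (fun z => H e z - _)]mixture_meanB// addrA subrK.
rewrite (eq_bigr _ (fun e _ => split_e e)) big_split/= -(natr1 m) mulrDl mul1r addrC.
apply: lerD; first by apply: IH => //; exact: ltnW.
(* The past is averaged under [p0] for every [e], so the sum over [e] moves inside and the one-step
   bound applies at each past [h]. *)
rewrite -[leLHS]mixture_mean_sum; last by move=> e; exact: bounded_measurableB.
rewrite -[leRHS](mixture_mean_cst (fun x : {ffun 'I_m -> 'I_K} => samples_law Q x)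
  (sum_data_weight m p0_simplex.2)).
apply: mixture_mean_le.
- by move=> x; exact: data_weight_ge0.
- by apply: bounded_measurable_sum => e; exact: bounded_measurableB.
- exact: bounded_measurable_cst.
move=> h.
apply: (@one_step_divergence _ _ _ _ (channel_at h) alpha _ _ _ p0 p tau s u v)
  => //.
- by move=> k l A mA; exact: Q_LDP.
- exact: p0_simplex.2.
- by move=> e; exact: (p_simplex e).2.
- by move=> e; exact: measurable_section.
Qed.

(** Chebyshev's inequality, applied given each data vector. [F] may fail to be square integrable, so
    the risk stays in the extended reals. *)
Lemma indicator_risk (q : 'I_K -> R) (gamma D : R) (F : samples (sample_space Q) n -> R)
    (A : set (samples (sample_space Q) n)) :
  (forall k, 0 <= q k) -> 0 <= D -> measurable A -> estimator F ->
  (forall z, A z -> D <= `|F z - power_sum gamma q|) ->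
  ((D ^+ 2 * samples_mean q \1_A)%:E <= risk gamma F q)%E.
Proof.
move=> q0 D0 mA mF AF; rewrite mulr_sumr -sumEFin; apply: lee_sum => x _.
rewrite mulrCA EFinM; apply: lee_pmul => //.
- by rewrite lee_fin prodr_ge0.
- by rewrite lee_fin mulr_ge0 ?sqr_ge0// Rintegral_ge0.
have b1 : bounded_measurable (\1_A : samples (sample_space Q) n -> R).
  apply: bounded_measurable01; first exact: measurable_indic.
  by move=> z; rewrite indicE; case: (z \in A); rewrite ?lexx ?ler01.
have bD1 := bounded_measurableZ (D ^+ 2) b1.
rewrite -(RintegralZl _ measurableT (bounded_measurable_integrable _ b1)).
rewrite /Rintegral fineK; last first.
  exact/(integrable_fin_num measurableT)/(bounded_measurable_integrable _ bD1).
rewrite unlock; apply: ge0_le_integral => //.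
- by move=> z _; rewrite lee_fin mulr_ge0 ?sqr_ge0.
- by apply/measurable_EFinP; exact: bD1.1.
- by apply/measurable_EFinP/measurable_funX/measurable_funB.
move=> z _; rewrite lee_fin indicE; case: (boolP (z \in A)) => [|_].
  rewrite inE => /AF zD; rewrite mulr1 -[leRHS]real_normK ?num_real//.
  by rewrite lerXn2r// nnegrE.
by rewrite mulr0 sqr_ge0.
Qed.

(** [A] is the event that [F] misses the value at [p0] by at least [D / 2]; off [A] it misses the
    value at each [p e] by that much. If [r] is the maximal risk, [y = r / (D / 2) ^+ 2] bounds both
    error probabilities, and the divergence bound forces [y] to be at least 1/6. *)
Lemma le_cam_mixture (gamma D : R) (F : samples (sample_space Q) n -> R) :
  estimator F -> 0 < D ->
  (forall e, D <= `|power_sum gamma (p e) - power_sum gamma p0|) ->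
  n%:R * (J%:R * (tau * a) ^+ 2) <= 2^-1 ->
  ((D ^+ 2 / 24)%:E <= max_risk gamma F)%E.
Proof.
move=> mF D0 sep small.
have risk_max q : simplex q -> (risk gamma F q <= max_risk gamma F)%E.
  by move=> sq; apply: ereal_sup_ubound; exists q.
pose A := [set z | D / 2 <= `|F z - power_sum gamma p0|].
have mA : measurable A.
  rewrite (_ : A = (fun z => `|F z - power_sum gamma p0|) @^-1` `[D / 2, +oo[); last first.
    by apply/seteqP; split => z; rewrite /A /= in_itv/= andbT.
  rewrite -[X in measurable X]setTI.
  have mnF : measurable_fun setT (fun z => `|F z - power_sum gamma p0|).
    by apply: measurableT_comp => //; exact: measurable_funB.
  exact: mnF.
have mCA : measurable (~` A) by exact: measurableC.
have D20 : 0 <= D / 2 by rewrite divr_ge0// ltW.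
have r0 : (((D / 2) ^+ 2 * samples_mean p0 \1_A)%:E <= max_risk gamma F)%E.
  apply: le_trans (risk_max _ p0_simplex); exact: indicator_risk.
have re e : (((D / 2) ^+ 2 * samples_mean (p e) \1_(~` A))%:E <= max_risk gamma F)%E.
  apply: le_trans (risk_max _ (p_simplex e)); apply: indicator_risk => // z.
  rewrite /A /= => /negP; rewrite -ltNge => zA.
  have := sep e; rewrite (_ : _ - _ = (F z - power_sum gamma p0) -
    (F z - power_sum gamma (p e))); last by ring.
  move=> /le_trans /(_ (ler_normB _ _)); lra.
have i01 (B : set (samples (sample_space Q) n)) z : 0 <= (\1_B z : R) <= 1.
  by rewrite indicE; case: (z \in B); rewrite ?lexx ?ler01.
have mi := measurable_indic.
have := @samples_divergence n (fun=> \1_(~` A)) (leqnn n)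
  (fun=> mi _ _ _ _ _ mCA) (fun=> i01 _).
(* Indicators are fixed by [phi], so for a test the first divergence term is a plain probability. *)
have phi1 : (fun z => phi (\1_(~` A) z : R)) = \1_(~` A).
  by apply/funext => z; rewrite indicE; case: (z \in _) => /=; ring.
rewrite phi1.
have p0C : samples_mean p0 \1_(~` A) = 1 - samples_mean p0 \1_A.
  rewrite -(mixture_mean_cst (fun x : {ffun 'I_n -> 'I_K} => samples_law Q x)
    (sum_data_weight n p0_simplex.2) 1).
  rewrite -mixture_meanB; last 2 first.
    exact: bounded_measurable_cst.
    by apply: bounded_measurable01 => //; exact: mi.
  congr samples_mean; apply/funext => z; rewrite !indicE in_setC.
  by case: (z \in A); rewrite /= ?subrr ?subr0.
rewrite p0C.
case: (max_risk gamma F) r0 re => [r| |] //=; last by rewrite !leey.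
rewrite !lee_fin => r0 re H.
have c0 : 0 < (D / 2) ^+ 2 by rewrite exprn_gt0// divr_gt0.
pose y := r / (D / 2) ^+ 2.
have y0 : samples_mean p0 \1_A <= y by rewrite ler_pdivlMr// mulrC.
have ye e : samples_mean (p e) \1_(~` A) <= y by rewrite ler_pdivlMr// mulrC -lee_fin.
have N0 : (0 : R) < #|E|%:R by rewrite ltr0n.
have {}H : #|E|%:R * (1 - 3 * y) <= #|E|%:R * 2^-1.
  apply: le_trans (le_trans _ H) _; last first.
    by rewrite mulrCA ler_pM2l.
  have -> : #|E|%:R * (1 - 3 * y) = \sum_(e : E) (1 - 3 * y).
    by rewrite sumr_const mulr_natl.
  (* Each term is at least [(1 - y) - 2 * y], because [phi x <= 2 * x]. *)
  apply: ler_sum => e _.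
  by have := ye e; have := sqr_ge0 (samples_mean (p e) \1_(~` A)); lra.
rewrite ler_pM2l// in H.
have y6 : 6^-1 <= y by lra.
rewrite (_ : D ^+ 2 / 24 = 6^-1 * (D / 2) ^+ 2); last by field.
by rewrite -ler_pdivlMr.
Qed.

End divergence.

(** * Bessel's inequality and Rademacher signs *)

(** [T] divided by [N] is the orthogonal projection of [w] on the span of the [s j]; the inequality
    is nonnegativity of the squared residual, expanded by orthogonality. *)
Lemma bessel_inequality (R : realFieldType) (E : finType) (J : nat)
    (s : 'I_J -> E -> R) (w : E -> R) : (0 < #|E|)%N ->
  (forall i j, \sum_e s i e * s j e = #|E|%:R * (i == j)%:R) ->
  \sum_(j < J) (\sum_e s j e * w e) ^+ 2 <= #|E|%:R * \sum_e w e ^+ 2.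
Proof.
move=> E0; have : (0 : R) < #|E|%:R by rewrite ltr0n.
move: (#|E|%:R : R) => N N0 ortho.
pose c j := \sum_e s j e * w e.
pose T e := \sum_(j < J) c j * s j e.
have : 0 <= \sum_e (N * w e - T e) ^+ 2.
  by apply: sumr_ge0 => e _; exact: sqr_ge0.
have -> : \sum_e (N * w e - T e) ^+ 2 =
    N ^+ 2 * (\sum_e w e ^+ 2) - 2 * N * (\sum_e w e * T e) + \sum_e T e ^+ 2.
  rewrite !mulr_sumr -sumrB -big_split; apply: eq_bigr => e _ /=.
  by move: (T e) => t; ring.
have -> : \sum_e w e * T e = \sum_(j < J) c j ^+ 2.
  under eq_bigr do rewrite mulr_sumr.
  rewrite exchange_big; apply: eq_bigr => j _ /=.
  under eq_bigr do rewrite mulrCA [w _ * _]mulrC.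
  by rewrite -mulr_sumr expr2.
have -> : \sum_e T e ^+ 2 = N * \sum_(j < J) c j ^+ 2.
  under eq_bigr do rewrite expr2 mulr_suml.
  rewrite exchange_big mulr_sumr; apply: eq_bigr => i _ /=.
  under eq_bigr do rewrite mulr_sumr.
  rewrite exchange_big /= (bigD1 i)//= [X in _ + X]big1 => [|j ji].
    under eq_bigr do rewrite mulrACA.
    by rewrite -mulr_sumr ortho eqxx mulr1 addr0 mulrC.
  under eq_bigr do rewrite mulrACA.
  by rewrite -mulr_sumr ortho eq_sym (negbTE ji) !mulr0.
have -> : N ^+ 2 * (\sum_e w e ^+ 2) - 2 * N * (\sum_(j < J) c j ^+ 2) +
    N * (\sum_(j < J) c j ^+ 2) =
    N * (N * (\sum_e w e ^+ 2) - \sum_(j < J) c j ^+ 2) by ring.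
by rewrite pmulr_rge0// subr_ge0.
Qed.

Section signs.
Context (R : realFieldType) (J : nat).

Definition sign (j : 'I_J) (e : {ffun 'I_J -> bool}) : R := (-1) ^+ e j.

(** For distinct indices, flipping coordinate [i] negates [sign i] and preserves [sign j], so the
    sum equals its own opposite. *)
Lemma sign_orthogonal (i j : 'I_J) :
  \sum_e sign i e * sign j e = #|{ffun 'I_J -> bool}|%:R * (i == j)%:R.
Proof.
have [<-|ij] := eqVneq i j.
  rewrite mulr1 (eq_bigr (fun=> 1)) ?sumr_const// => e _.
  by rewrite -expr2 sqrr_sign.
rewrite mulr0; set S := LHS.
pose flip (e : {ffun 'I_J -> bool}) := [ffun k => e k (+) (k == i)].
have flipK : involutive flip.
  by move=> e; apply/ffunP => k; rewrite !ffunE addbK.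
have : S = - S.
  rewrite {1}/S (reindex_inj (inv_inj flipK)) -sumrN; apply: eq_bigr => e _.
  by rewrite /sign !ffunE eqxx eq_sym (negbTE ij) addbT addbF signrN mulNr.
by lra.
Qed.

End signs.

(** * Distributions perturbed on pairs of letters *)

Section paired_distribution.
Context (R : realType) (K J : nat) (delta : R).
Hypothesis J_K : (J.+1.*2 <= K)%N.

(** Letters [2j] and [2j + 1] form pair [j]. The last of the [K.+1] letters lies outside the pairs
    because [J.+1.*2 <= K]; it carries the remaining mass, whatever [sigma] is. Zero [sigma] gives
    the null distribution, signs give the alternatives. *)
Definition paired (sigma : 'I_J.+1 -> R) (k : 'I_K.+1) : R :=
  if (k < J.+1.*2)%N then delta * (1 + (-1) ^+ odd k * sigma (inord k./2))
  else if k == ord_max then 1 - J.+1.*2%:R * delta else 0.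

Definition pair_fst (j : 'I_J.+1) : 'I_K.+1 := inord j.*2.
Definition pair_snd (j : 'I_J.+1) : 'I_K.+1 := inord j.*2.+1.

Lemma pair_ltn (j : 'I_J.+1) : (j.*2.+1 < J.+1.*2)%N.
Proof. by rewrite -[leqLHS]/(j.+1.*2) leq_double. Qed.

Lemma paired_fst sigma j : paired sigma (pair_fst j) = delta * (1 + sigma j).
Proof.
have jJ := pair_ltn j; have jJ' := ltnW jJ.
rewrite /paired /pair_fst inordK; last by rewrite ltnS ltnW// (leq_trans jJ' J_K).
by rewrite jJ' odd_double mul1r doubleK inord_val.
Qed.

Lemma paired_snd sigma j : paired sigma (pair_snd j) = delta * (1 - sigma j).
Proof.
have jJ := pair_ltn j.
rewrite /paired /pair_snd inordK; last by rewrite ltnS ltnW// (leq_trans jJ J_K).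
by rewrite jJ /= odd_double /= uphalf_double inord_val mulN1r.
Qed.

Lemma paired_max sigma : paired sigma ord_max = 1 - J.+1.*2%:R * delta.
Proof. by rewrite /paired /= ltnNge J_K eqxx. Qed.

Lemma sum_pairs (h : 'I_K.+1 -> R) :
  (forall k : 'I_K.+1, (J.+1.*2 <= k)%N -> k != ord_max -> h k = 0) ->
  \sum_k h k = \sum_(j < J.+1) (h (pair_fst j) + h (pair_snd j)) + h ord_max.
Proof.
move=> h0; rewrite big_ord_recr /=; congr (_ + _).
pose H i := h (inord i).
rewrite (eq_bigr (fun i : 'I_K => H i)); last first.
  move=> i _; congr h; apply/val_inj; rewrite /= inordK//.
  exact: ltn_trans (ltn_ord i) _.
rewrite -(big_mkord xpredT H) (big_cat_nat (n := J.+1.*2))//=.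
rewrite [X in _ + X]big_nat_cond [X in _ + X]big1 ?addr0; last first.
  move=> i; rewrite andbT => /andP[Ji iK]; apply: h0; rewrite ?inordK ?leqW//.
  by apply/eqP => /(congr1 val); rewrite /= inordK ?leqW// => iE; rewrite iE ltnn in iK.
rewrite (eq_bigr (fun j : 'I_J.+1 => H j.*2 + H j.*2.+1))//.
rewrite -(big_mkord xpredT (fun j => H j.*2 + H j.*2.+1)).
elim: J.+1 => [|m IH]; first by rewrite !big_nil.
by rewrite doubleS !big_nat_recr//= IH addrA.
Qed.

Lemma sum_paired sigma (x : 'I_K.+1 -> R) :
  \sum_k paired sigma k * x k =
  delta * (\sum_(j < J.+1)
    ((1 + sigma j) * x (pair_fst j) + (1 - sigma j) * x (pair_snd j)))
  + (1 - J.+1.*2%:R * delta) * x ord_max.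
Proof.
rewrite sum_pairs => [|k Jk kK]; last first.
  by rewrite /paired ltnNge Jk (negbTE kK) mul0r.
rewrite paired_max mulr_sumr; congr (_ + _); apply: eq_bigr => j _.
by rewrite paired_fst paired_snd; ring.
Qed.

Lemma sum_paired1 sigma : \sum_k paired sigma k = 1.
Proof.
under eq_bigr do rewrite -[paired _ _]mulr1.
rewrite sum_paired (eq_bigr (fun=> 2)) => [|j _]; last by ring.
by rewrite sumr_const card_ord -mulr_natl -muln2 natrM; ring.
Qed.

Lemma paired_simplex sigma : 0 <= delta -> J.+1.*2%:R * delta <= 1 ->
  (forall j, `|sigma j| <= 1) -> simplex (paired sigma).
Proof.
move=> d0 d1 s1.
have p0 k : 0 <= paired sigma k.
  rewrite /paired; case: ifP => _.
    rewrite mulr_ge0//; have := s1 (inord k./2); rewrite ler_norml => /andP[? ?].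
    by case: odd => /=; lra.
  by case: ifP => _ //; rewrite subr_ge0.
split; last exact: sum_paired1.
move=> k; rewrite p0 /= -(sum_paired1 sigma) (bigD1 k)//= lerDl.
by apply: sumr_ge0.
Qed.

(** A nonzero exponent makes empty letters contribute nothing, since zero to the power zero is 1 for
    [powR]. *)
Lemma power_sum_paired gamma sigma : gamma != 0 ->
  power_sum gamma (paired sigma) =
  \sum_(j < J.+1) ((delta * (1 + sigma j)) `^ gamma + (delta * (1 - sigma j)) `^ gamma)
  + (1 - J.+1.*2%:R * delta) `^ gamma.
Proof.
move=> g0; rewrite /power_sum sum_pairs => [|k Jk kK]; last first.
  by rewrite /paired ltnNge Jk (negbTE kK) powR0.
rewrite paired_max; congr (_ + _); apply: eq_bigr => j _.
by rewrite paired_fst paired_snd.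
Qed.

End paired_distribution.

(** * Bounds on the privacy factor *)

Section noise.
Context (R : realType) (alpha : R).

(** The difference of squares factors through [expR alpha + expR (- alpha)], which is at least 2.
    This passes from the factor of the one-step bound to the one in the rates. *)
Lemma sinh_double_ge :
  4 * (expR alpha - expR (- alpha)) ^+ 2 <=
  (expR (2 * alpha) - expR (- (2 * alpha))) ^+ 2.
Proof.
have e2 (x : R) : expR (2 * x) = expR x ^+ 2.
  by rewrite expr2 -expRD; congr expR; ring.
rewrite -mulrN !e2.
set a := expR alpha; set b := expR (- alpha).
have ab : 2 <= a + b.
  by have := expR_ge1Dx alpha; have := expR_ge1Dx (- alpha); rewrite -/a -/b; lra.
rewrite subr_sqr exprMn mulrC ler_wpM2l ?sqr_ge0//; nra.
Qed.

Lemma sinh_double_sqr_ge : 0 < alpha ->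
  4 * alpha ^+ 2 <= (expR (2 * alpha) - expR (- (2 * alpha))) ^+ 2.
Proof.
move=> a0; have a1 := expR_ge1Dx (2 * alpha).
have b1 : expR (- (2 * alpha)) <= 1.
  by rewrite -[leRHS]expR0 ler_expR oppr_le0 mulr_ge0// ltW.
rewrite (_ : 4 * alpha ^+ 2 = (2 * alpha) ^+ 2); last by ring.
rewrite lerXn2r ?nnegrE//; lra.
Qed.

End noise.

(** * Lower bounds for a given perturbation size *)

Section lower_bounds.
Context (R : realType) (n : nat) (alpha : R).
Local Notation N := (n%:R * (expR (2 * alpha) - expR (- (2 * alpha))) ^+ 2).

(** Relative change of the power sum over a pair when one letter is doubled and the other emptied;
    it degenerates at exponent 1, where the power sum is constant. *)
Lemma two_powR_gap (gamma : R) : gamma != 1 -> 0 < `|1 - 2 `^ (gamma - 1)|.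
Proof.
move=> g1; rewrite normr_gt0 subr_eq0 eq_sym powR_eq1 !negb_or subr_eq0 g1.
by rewrite -leNgt ler0n pnatr_eq1.
Qed.

Lemma paired_lower_bound (K J : nat) (gamma delta : R) (Q : mechanism R K.+1)
    (F : samples (sample_space Q) n -> R) :
  LDP n alpha Q -> estimator F -> 0 < gamma -> gamma != 1 ->
  (J.+1.*2 <= K)%N -> 0 < delta -> J.+1.*2%:R * delta <= 1 ->
  N * J.+1%:R * delta ^+ 2 <= 2 ->
  (((J.+1.*2%:R * (delta `^ gamma * `|1 - 2 `^ (gamma - 1)|)) ^+ 2 / 24)%:E <=
    max_risk gamma F)%E.
Proof.
move=> Q_LDP mF g0 g1 JK d0 d1 small.
pose p0 : 'I_K.+1 -> R := paired delta (fun _ : 'I_J.+1 => 0).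
pose p (e : {ffun 'I_J.+1 -> bool}) : 'I_K.+1 -> R :=
  paired delta (fun j => sign R j e).
have s1 (j : 'I_J.+1) e : `|sign R j e| = 1 by rewrite normr_sign.
have E0 : (0 < #|{ffun 'I_J.+1 -> bool}|)%N.
  by apply/card_gt0P; exists [ffun=> false].
have := @le_cam_mixture R K.+1 Q n alpha Q_LDP _ J.+1 p0 p delta
  (@sign R J.+1) (@pair_fst K J) (@pair_snd K J) _ _ E0 (ltW d0) _ _ gamma _ F mF.
apply.
- by apply: paired_simplex => // [|j]; [exact: ltW|rewrite normr0].
- by move=> e; apply: paired_simplex => // [|j]; [exact: ltW|rewrite s1].
- by move=> w; apply: bessel_inequality => // i j; exact: sign_orthogonal.
- move=> e x; rewrite !sum_paired// addrAC -mulrDr -big_split/=.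
  by congr (_ * _ + _); apply: eq_bigr => j _; ring.
- by rewrite mulr_gt0 ?ltr0n ?double_gt0// mulr_gt0 ?powR_gt0 ?two_powR_gap.
- move=> e; rewrite !power_sum_paired ?gt_eqF// opprD addrACA subrr addr0.
  (* Whatever its sign, a pair ends with masses [delta * 2] and 0, so its contribution changes by
     the same amount for every [e]. *)
  rewrite -sumrB (eq_bigr (fun=> 2 * (delta `^ gamma * (2 `^ (gamma - 1) - 1)))).
    rewrite sumr_const card_ord -[_ *+ J.+1]mulr_natl -muln2 natrM -mulrA !normrM.
    by rewrite !normr_nat (ger0_norm (powR_ge0 _ _)) distrC.
  have two : (delta * 2) `^ gamma = 2 * (delta `^ gamma * 2 `^ (gamma - 1)).
    by rewrite powRM ?ltW// -(mulr_powRB1 (ler0n R 2) g0); ring.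
  move=> j _; rewrite addr0 subr0 mulr1 /sign; case: (e j).
    rewrite expr1 opprK subrr mulr0 powR0 ?gt_eqF// add0r two; ring.
  rewrite expr0 subrr mulr0 powR0 ?gt_eqF// two; ring.
(* The factor 4 of [sinh_double_ge] turns the assumed bound 2 into the required 1/2. *)
- have := sinh_double_ge alpha => sh.
  apply: le_trans (_ : 4^-1 * (N * J.+1%:R * delta ^+ 2) <= _); last by lra.
  have : 0 <= n%:R * J.+1%:R * delta ^+ 2 :> R by rewrite mulr_ge0// sqr_ge0.
  nra.
Qed.

(** A two-point comparison: a single alternative and a single direction of constant sign 1, moving
    mass [delta] from the first letter to the second. *)
Lemma binary_lower_bound (gamma delta : R) (Q : mechanism R 2)
    (F : samples (sample_space Q) n -> R) :
  LDP n alpha Q -> estimator F -> 0 < gamma -> gamma != 1 ->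
  0 < delta <= 2^-1 -> N * delta ^+ 2 <= 2 ->
  (((delta `^ gamma * `|1 - 2 `^ (gamma - 1)|) ^+ 2 / 24)%:E <= max_risk gamma F)%E.
Proof.
move=> Q_LDP mF g0 g1 /andP[d0 d12] small.
pose p0 (k : 'I_2) : R := if k == ord0 then delta else 1 - delta.
pose p1 (e : 'I_1) (k : 'I_2) : R := if k == ord0 then 0 else 1.
have E0 : (0 < #|'I_1|)%N by rewrite card_ord.
have := @le_cam_mixture R 2 Q n alpha Q_LDP _ 1 p0 p1 delta
  (fun _ _ => 1) (fun=> ord_max) (fun=> ord0) _ _ E0 (ltW d0) _ _ gamma _ F mF.
apply.
- split=> [k|]; first by rewrite /p0; case: ifP => _; apply/andP; split; lra.
  by rewrite !big_ord_recl big_ord0 /p0 /= addr0; lra.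
- move=> e; split=> [k|]; first by rewrite /p1; case: ifP => _; rewrite ?lexx ?ler01.
  by rewrite !big_ord_recl big_ord0 /p1 /=; lra.
- by move=> w; rewrite card_ord !big_ord1 !mul1r.
- move=> e x; rewrite big_ord1 !big_ord_recl !big_ord0 /p0 /p1 /=.
  rewrite (_ : lift ord0 ord0 = ord_max); last by apply/val_inj.
  ring.
- by rewrite mulr_gt0 ?powR_gt0 ?two_powR_gap.
- move=> e.
  have -> : power_sum gamma (p1 e) = 1.
    by rewrite /power_sum !big_ord_recl big_ord0 /p1 /= powR0 ?gt_eqF// powR1; lra.
  have -> : power_sum gamma p0 = delta `^ gamma + (1 - delta) `^ gamma.
    by rewrite /power_sum !big_ord_recl big_ord0 /p0 /= addr0.
  have b0 : 0 < 1 - delta <= 1 by lra.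
  (* This identity compares [C * A] with [delta], as [delta * 2 <= 1]: below exponent 1 one gets
     [1 - B <= delta <= C * A], above it [C * A <= delta <= 1 - B]. *)
  have two : 2 `^ (gamma - 1) * delta `^ gamma = delta * (delta * 2) `^ (gamma - 1).
    by rewrite powRM ?ltW// mulrA mulr_powRB1 ?ltW// mulrC.
  have d2 : 0 < delta * 2 <= 1 by lra.
  have d2z : (delta * 2) `^ 0 = 1 by rewrite powRr0.
  set A := delta `^ gamma in two *; set B := (1 - delta) `^ gamma.
  have A0 : 0 < A by exact: powR_gt0.
  set C := 2 `^ (gamma - 1) in two *.
  have [lt1|gt1|/eqP] := ltgtP gamma 1; last by rewrite (negbTE g1).
    have B1 : 1 - delta <= B by apply: ger1_powR => //; exact: ltW.
    have C1 : C <= 1.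
      by rewrite -(powRr0 2) ler_powR ?ler1n//; lra.
    have D1 : 1 <= (delta * 2) `^ (gamma - 1) by rewrite -[leLHS]d2z ger_powR//; lra.
    rewrite ger0_norm ?subr_ge0// ler0_norm; nra.
  have B1 : B <= 1 - delta by apply: ge1r_powR => //; exact: ltW.
  have C1 : 1 <= C.
    by rewrite -[leLHS](powRr0 2) ler_powR ?ler1n//; lra.
  have D1 : (delta * 2) `^ (gamma - 1) <= 1 by rewrite -[leRHS]d2z ger_powR//; lra.
  have AD : C * A <= delta by rewrite two ler_piMr// ltW.
  rewrite ler0_norm ?subr_le0// ger0_norm; nra.
- have := sinh_double_ge alpha => sh.
  apply: le_trans (_ : 4^-1 * (N * delta ^+ 2) <= _); last by lra.
  have : 0 <= n%:R * delta ^+ 2 :> R by rewrite mulr_ge0// sqr_ge0.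
  nra.
Qed.

End lower_bounds.

(** * Choice of the perturbation size *)

Section rates.
Context (R : realType) (n : nat) (alpha : R).
Local Notation N := (n%:R * (expR (2 * alpha) - expR (- (2 * alpha))) ^+ 2).

Lemma powR_sqr (x gamma : R) : 0 <= x -> (x `^ gamma) ^+ 2 = (x ^+ 2) `^ gamma.
Proof. by move=> x0; rewrite !expr2 powRM. Qed.

Lemma powR_inv (x gamma : R) : 0 < x -> (x^-1) `^ gamma = (x `^ gamma)^-1.
Proof. by move=> x0; rewrite -powR_inv1 ?ltW// -powRrM mulN1r powRN. Qed.

Lemma powR_2B (x gamma : R) : 0 < x -> x `^ (2 - gamma) = x ^+ 2 / x `^ gamma.
Proof.
by move=> x0; rewrite powRB ?powR_mulrn ?ltW// (gt_eqF x0) implybT.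
Qed.

(** With [delta] the inverse square root of [j * N], the noise condition holds with value 1, and
    [4 * j <= N] says exactly that the pairs have total mass at most 1. *)
Lemma dense_lower_bound (K J : nat) (gamma : R) (Q : mechanism R K.+1)
    (F : samples (sample_space Q) n -> R) :
  LDP n alpha Q -> estimator F -> 0 < gamma -> gamma != 1 ->
  (J.+1.*2 <= K)%N -> 4 * J.+1%:R <= N ->
  ((`|1 - 2 `^ (gamma - 1)| ^+ 2 / 6 * (J.+1%:R `^ (2 - gamma) / N `^ gamma))%:E <=
    max_risk gamma F)%E.
Proof.
move=> Q_LDP mF g0 g1 JK JN; set j : R := J.+1%:R.
have j0 : 0 < j by rewrite ltr0n.
have N0 : 0 < N by apply: lt_le_trans JN; rewrite mulr_gt0.
have jN : 0 < j * N by exact: mulr_gt0.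
have jN0 : 0 < (j * N)^-1 by rewrite invr_gt0.
pose delta := Num.sqrt (j * N)^-1.
have d0 : 0 < delta by rewrite sqrtr_gt0.
have d2 : delta ^+ 2 = (j * N)^-1 by rewrite sqr_sqrtr ?ltW.
have jd1 : J.+1.*2%:R * delta <= 1.
  rewrite -(@ler_pXn2r _ 2)// ?nnegrE ?mulr_ge0// ?(ltW d0)// expr1n exprMn d2.
  rewrite -muln2 natrM -/j ler_pdivrMr// mul1r.
  have e (x : R) : (x * 2) ^+ 2 = x * (4 * x) by ring.
  by rewrite e ler_pM2l.
have small : N * j * delta ^+ 2 <= 2.
  by rewrite d2 (mulrC N) divff ?ler1n// gt_eqF.
apply: le_trans (paired_lower_bound Q_LDP mF g0 g1 JK d0 jd1 small).
rewrite lee_fin !exprMn (powR_sqr _ (ltW d0)) d2 powR_inv//.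
rewrite (powRM _ (ltW j0) (ltW N0)) powR_2B//.
rewrite -muln2 natrM -/j le_eqVlt; apply/orP; left; apply/eqP.
by field; rewrite !gt_eqF ?powR_gt0.
Qed.

(** Here the pairs carry all the mass: [delta] is the inverse of [2 * j], and [N <= 4 * j] keeps
    [N * j * delta ^+ 2] at most 1. *)
Lemma sparse_lower_bound (K J : nat) (gamma : R) (Q : mechanism R K.+1)
    (F : samples (sample_space Q) n -> R) :
  LDP n alpha Q -> estimator F -> 0 < gamma -> gamma != 1 ->
  (J.+1.*2 <= K)%N -> N <= 4 * J.+1%:R ->
  ((`|1 - 2 `^ (gamma - 1)| ^+ 2 / 24 * J.+1.*2%:R `^ (2 * (1 - gamma)))%:E <=
    max_risk gamma F)%E.
Proof.
move=> Q_LDP mF g0 g1 JK NJ; set j2 : R := J.+1.*2%:R.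
have j2E : j2 = 2 * J.+1%:R by rewrite /j2 -muln2 natrM mulrC.
have j0 : 0 < j2 by rewrite ltr0n double_gt0.
have j20 : 0 < j2^-1 by rewrite invr_gt0.
have jd1 : J.+1.*2%:R * j2^-1 <= 1 by rewrite divff ?gt_eqF.
have small : N * J.+1%:R * j2^-1 ^+ 2 <= 2.
  rewrite exprVn ler_pdivrMr ?exprn_gt0// j2E.
  have : (0 : R) <= J.+1%:R by [].
  nra.
apply: le_trans (paired_lower_bound Q_LDP mF g0 g1 JK j20 jd1 small).
rewrite lee_fin !exprMn powR_inv// -/j2.
rewrite (_ : 2 * (1 - gamma) = (1 - gamma) * 2%:R); last by ring.
have jB : j2 `^ (1 - gamma) = j2 / j2 `^ gamma.
  by rewrite powRB ?(powRr1 (ltW j0))// (gt_eqF j0) implybT.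
rewrite powRrM powR_mulrn ?powR_ge0// jB.
rewrite le_eqVlt; apply/orP; left; apply/eqP.
by field; rewrite !gt_eqF ?powR_gt0.
Qed.

Lemma binary_rate (gamma : R) (Q : mechanism R 2)
    (F : samples (sample_space Q) n -> R) :
  LDP n alpha Q -> estimator F -> 0 < gamma < 2 -> gamma != 1 -> 4 <= N ->
  ((`|1 - 2 `^ (gamma - 1)| ^+ 2 / 96 * (2 `^ (2 - gamma) / N `^ gamma))%:E <=
    max_risk gamma F)%E.
Proof.
move=> Q_LDP mF /andP[g0 g2] g1 N4.
have N0 : 0 < N by apply: lt_le_trans N4.
have iN0 : 0 < N^-1 by rewrite invr_gt0.
pose delta := Num.sqrt N^-1.
have d0 : 0 < delta by rewrite sqrtr_gt0.
have d2 : delta ^+ 2 = N^-1 by rewrite sqr_sqrtr ?ltW.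
have dh : 0 < delta <= 2^-1.
  rewrite d0 /= -(@ler_pXn2r _ 2)// ?nnegrE ?(ltW d0)// d2 exprVn lef_pV2 ?posrE ?exprn_gt0//.
  by rewrite -natrX.
have small : N * delta ^+ 2 <= 2 by rewrite d2 divff ?gt_eqF// ler1n.
apply: le_trans (binary_lower_bound Q_LDP mF g0 g1 dh small).
rewrite lee_fin !exprMn (powR_sqr _ (ltW d0)) d2 powR_inv//.
(* This factor 4 turns the constant 24 into 96. *)
have le4 : 2 `^ (2 - gamma) <= 4 :> R.
  apply: le_trans (_ : 2 `^ 2 <= _); first by rewrite ler_powR ?ler1n//; lra.
  by rewrite powR_mulrn// -natrX.
have : 0 <= `|1 - 2 `^ (gamma - 1)| ^+ 2 / N `^ gamma.
  by rewrite divr_ge0 ?sqr_ge0 ?powR_ge0.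
nra.
Qed.

End rates.

(** * Bounds uniform in the alphabet size *)

Section minimax.
Context (R : realType) (n : nat) (alpha : R).
Local Notation N := (n%:R * (expR (2 * alpha) - expR (- (2 * alpha))) ^+ 2).

Lemma half_pairs (K : nat) : (2 <= K)%N ->
  exists J, (J.+1.*2 <= K)%N /\ K.+1%:R <= 4 * J.+1%:R :> R.
Proof.
move=> K2; exists K./2.-1.
have h0 : (0 < K./2)%N by rewrite half_gt0.
rewrite prednK//; split; first by rewrite -{2}(odd_double_half K) leq_addl.
rewrite -natrM ler_nat -{1}(odd_double_half K).
by case: (odd K); rewrite -muln2; lia.
Qed.

Lemma dense_rate (K J : nat) (gamma : R) (Q : mechanism R K.+1)
    (F : samples (sample_space Q) n -> R) :
  LDP n alpha Q -> estimator F -> 0 < gamma < 2 -> gamma != 1 ->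
  (J.+1.*2 <= K)%N -> 4 * J.+1%:R <= N -> K.+1%:R <= 4 * J.+1%:R :> R ->
  ((`|1 - 2 `^ (gamma - 1)| ^+ 2 / 96 * (K.+1%:R `^ (2 - gamma) / N `^ gamma))%:E <=
    max_risk gamma F)%E.
Proof.
move=> Q_LDP mF /andP[g0 g2] g1 JK JN KJ.
apply: le_trans (dense_lower_bound Q_LDP mF g0 g1 JK JN).
(* Replacing [J.+1] by the alphabet size costs at most [4 ^+ 2], and 6 times 16 is 96. *)
have K16 : K.+1%:R `^ (2 - gamma) <= 16 * J.+1%:R `^ (2 - gamma).
  apply: le_trans (_ : (4 * J.+1%:R) `^ (2 - gamma) <= _).
    by rewrite ge0_ler_powR ?nnegrE ?mulr_ge0//; lra.
  rewrite powRM// ler_wpM2r ?powR_ge0//.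
  apply: le_trans (_ : 4 `^ 2 <= _); first by rewrite ler_powR ?ler1n//; lra.
  by rewrite powR_mulrn// -natrX.
have : 0 <= `|1 - 2 `^ (gamma - 1)| ^+ 2 / N `^ gamma.
  by rewrite divr_ge0 ?sqr_ge0 ?powR_ge0.
rewrite lee_fin; nra.
Qed.

Lemma max_risk_lt1 (K : nat) (gamma : R) (Q : mechanism R K)
    (F : samples (sample_space Q) n -> R) :
  (2 <= K)%N -> LDP n alpha Q -> estimator F -> 0 < gamma < 1 -> 4 <= N ->
  ((`|1 - 2 `^ (gamma - 1)| ^+ 2 / 96 *
    Num.min (K%:R `^ (2 * (1 - gamma))) (K%:R `^ (2 - gamma) / N `^ gamma))%:E <=
    max_risk gamma F)%E.
Proof.
case: K Q F => [|[|[|K]]]// Q F _ Q_LDP mF /andP[g0 g1] N4.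
all: have gn1 : gamma != 1 by rewrite lt_eqF.
all: have g2 : gamma < 2 by lra.
all: have c0 : 0 <= `|1 - 2 `^ (gamma - 1)| ^+ 2 / 96 by rewrite divr_ge0 ?sqr_ge0.
  have := binary_rate Q_LDP mF (_ : 0 < gamma < 2) gn1 N4; rewrite g0 g2 => /(_ isT).
  apply: le_trans; rewrite lee_fin ler_wpM2l// ge_min; lra.
have [J [JK KJ]] := @half_pairs K.+2 isT.
have [JN|JN] := leP (4 * J.+1%:R) N.
  have := dense_rate Q_LDP mF (_ : 0 < gamma < 2) gn1 JK JN KJ; rewrite g0 g2 => /(_ isT).
  apply: le_trans; rewrite lee_fin ler_wpM2l// ge_min lexx orbT//.
apply: le_trans (sparse_lower_bound Q_LDP mF g0 gn1 JK (ltW JN)).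
(* The base at most doubles and the exponent is below 2, so the loss is at most 4, and 24 times 4 is
   96. *)
have K4 : K.+3%:R `^ (2 * (1 - gamma)) <= 4 * J.+1.*2%:R `^ (2 * (1 - gamma)).
  apply: le_trans (_ : (2 * J.+1.*2%:R) `^ (2 * (1 - gamma)) <= _).
    rewrite ge0_ler_powR ?nnegrE ?mulr_ge0//; first by lra.
    by rewrite -muln2 natrM; lra.
  rewrite powRM// ler_wpM2r ?powR_ge0//.
  apply: le_trans (_ : 2 `^ 2 <= _); first by rewrite ler_powR ?ler1n//; lra.
  by rewrite powR_mulrn// -natrX.
rewrite lee_fin; set m := Num.min _ _.
have mK : m <= K.+3%:R `^ (2 * (1 - gamma)) by rewrite ge_min lexx.
nra.
Qed.

Lemma max_risk_gt1 (K : nat) (gamma : R) (Q : mechanism R K)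
    (F : samples (sample_space Q) n -> R) :
  (2 <= K)%N -> LDP n alpha Q -> estimator F -> 1 < gamma < 2 -> 4 <= N ->
  ((`|1 - 2 `^ (gamma - 1)| ^+ 2 / 96 *
    Num.min (1 / N `^ (2 * (gamma - 1))) (K%:R `^ (2 - gamma) / N `^ gamma))%:E <=
    max_risk gamma F)%E.
Proof.
case: K Q F => [|[|[|K]]]// Q F _ Q_LDP mF /andP[g1 g2] N4.
all: have gn1 : gamma != 1 by rewrite gt_eqF.
all: have g0 : 0 < gamma by lra.
all: have c0 : 0 <= `|1 - 2 `^ (gamma - 1)| ^+ 2 / 96 by rewrite divr_ge0 ?sqr_ge0.
  have := binary_rate Q_LDP mF (_ : 0 < gamma < 2) gn1 N4; rewrite g0 g2 => /(_ isT).
  apply: le_trans; rewrite lee_fin ler_wpM2l// ge_min lexx orbT//.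
have [J [JK KJ]] := @half_pairs K.+2 isT.
have [JN|JN] := leP (4 * J.+1%:R) N.
  have := dense_rate Q_LDP mF (_ : 0 < gamma < 2) gn1 JK JN KJ; rewrite g0 g2 => /(_ isT).
  apply: le_trans; rewrite lee_fin ler_wpM2l// ge_min lexx orbT//.
(* Too many pairs for the noise level: only the integer part of [N / 4] of them, at least one, are
   perturbed. *)
have N0 : 0 < N by exact: lt_le_trans N4.
have N41 : 1 <= N / 4 by lra.
have /andP[tl tu] := truncn_itv (le_trans ler01 N41).
have : (0 < Num.truncn (N / 4))%N by rewrite truncn_gt0.
case E : (Num.truncn (N / 4)) tl tu => [//|j] tl tu _.
have jN : 4 * j.+1%:R <= N by lra.
have jJ : (j <= J)%N.
  have : j.+1%:R < J.+1%:R :> R by lra.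
  by rewrite ltr_nat ltnS => /ltnW.
have jK : (j.+1.*2 <= K.+2)%N by apply: leq_trans JK; rewrite leq_double.
apply: le_trans (dense_lower_bound Q_LDP mF g0 gn1 jK jN).
(* [N / 4] is less than [j.+2], which is at most [2 * j.+1]. *)
have j8 : N <= 8 * j.+1%:R.
  have : (1 : R) <= j.+1%:R by rewrite ler1n.
  by move: tu; rewrite -natr1; lra.
have N8 : N `^ (2 - gamma) <= 8 * j.+1%:R `^ (2 - gamma).
  apply: le_trans (_ : (8 * j.+1%:R) `^ (2 - gamma) <= _).
    by rewrite ge0_ler_powR ?nnegrE ?(ltW N0)//; lra.
  rewrite powRM// ler_wpM2r ?powR_ge0//.
  apply: le_trans (_ : 8 `^ 1 <= _); first by rewrite ler_powR ?ler1n//; lra.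
  by rewrite powRr1.
(* The first term of the minimum is the dense rate with [N] in place of the alphabet size. *)
have NE : 1 / N `^ (2 * (gamma - 1)) = N `^ (2 - gamma) / N `^ gamma.
  rewrite -powRB; last by rewrite (gt_eqF N0) implybT.
  by rewrite div1r -powRN; congr (_ `^ _); ring.
rewrite lee_fin; set m := Num.min _ _.
have mN : m <= N `^ (2 - gamma) / N `^ gamma by rewrite -NE ge_min lexx.
have Ng : 0 <= (N `^ gamma)^-1 by rewrite invr_ge0 powR_ge0.
have m8 : m <= 8 * (j.+1%:R `^ (2 - gamma) / N `^ gamma).
  by apply: le_trans mN _; rewrite mulrA ler_wpM2r.
have : 0 <= j.+1%:R `^ (2 - gamma) / N `^ gamma by rewrite mulr_ge0 ?powR_ge0.
nra.
Qed.

End minimax.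

Theorem theorem2p7 (R : realType) :
  (forall gamma : R, 0 < gamma < 1 ->
    exists2 c : R, 0 < c &
    forall (K n : nat) (alpha : R),
      (2 <= K)%N -> (0 < n)%N -> 0 < alpha < 1 -> 1 <= alpha ^+ 2 * n%:R ->
      let N := n%:R * (expR (2 * alpha) - expR (- (2 * alpha))) ^+ 2 in
      ((c * Num.min (K%:R `^ (2 * (1 - gamma)))
                    (K%:R `^ (2 - gamma) / N `^ gamma))%:E
       <= ereal_inf
            [set r | exists (Q : mechanism R K)
                            (F : samples (sample_space Q) n -> R),
                [/\ LDP n alpha Q, estimator F & r = max_risk gamma F]])%E)
  /\
  (forall gamma : R, 1 < gamma < 2 ->
    exists2 c : R, 0 < c &
    forall (K n : nat) (alpha : R),
      (2 <= K)%N -> (0 < n)%N -> 0 < alpha < 1 -> 1 <= alpha ^+ 2 * n%:R ->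
      let N := (expR (2 * alpha) - expR (- (2 * alpha))) ^+ 2 * n%:R in
      ((c * Num.min (1 / N `^ (2 * (gamma - 1)))
                    (K%:R `^ (2 - gamma) / N `^ gamma))%:E
       <= ereal_inf
            [set r | exists2 Q : mechanism R K, LDP n alpha Q &
               r = ereal_inf [set max_risk gamma F | F in @estimator R K n Q]])%E).
Proof.
have c0 (gamma : R) : gamma != 1 -> 0 < `|1 - 2 `^ (gamma - 1)| ^+ 2 / 96.
  by move=> g1; rewrite divr_gt0// exprn_gt0// two_powR_gap.
(* The regime [1 <= alpha ^+ 2 * n] gives [4 <= N]: the two-letter perturbation is then at most 1/2,
   and at least one pair is affordable above exponent 1. *)
have N4 (n : nat) (alpha : R) : 0 < alpha -> 1 <= alpha ^+ 2 * n%:R ->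
    4 <= n%:R * (expR (2 * alpha) - expR (- (2 * alpha))) ^+ 2.
  move=> a0 an; have := sinh_double_sqr_ge a0; have : (0 : R) <= n%:R by []; nra.
split=> gamma g.
  exists (`|1 - 2 `^ (gamma - 1)| ^+ 2 / 96).
    by apply: c0; rewrite lt_eqF//; case/andP: g.
  move=> K n alpha K2 n0 /andP[a0 _] an /=.
  apply: le_ereal_inf_tmp => _ [Q [F [Q_LDP mF ->]]].
  by apply: max_risk_lt1 => //; exact: N4.
exists (`|1 - 2 `^ (gamma - 1)| ^+ 2 / 96).
  by apply: c0; rewrite gt_eqF//; case/andP: g.
move=> K n alpha K2 n0 /andP[a0 _] an /=.
apply: le_ereal_inf_tmp => _ [Q Q_LDP ->].
apply: le_ereal_inf_tmp => _ [F mF <-].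
by rewrite [_ ^+ 2 * n%:R]mulrC; apply: max_risk_gt1 => //; exact: N4.
Qed.
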